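(* Let $A$ be a finite alphabet, $u\in A^*$ and $k\in\{1,\ldots,|u|\}$. The sequence $\left(\binom{u}{x}_q\right)_{x\in A^k}$ uniquely determines the word $u$; that is, if $u'\in A^*$ satisfies $\binom{u'}{x}_q=\binom{u}{x}_q$ for all $x\in A^k$, then $u'=u$.
   Context: $A^*$ is the free monoid of finite words over $A$ (with concatenation and empty word $\varepsilon$), $|w|$ is the length of a word $w$, and $A^k$ is the set of words of length $k$. The $q$-binomial coefficient $\binom{u}{v}_q\in\mathbb{N}[q]$ of two words $u,v\in A^*$ is defined recursively by $\binom{u}{\varepsilon}_q=1$, $\binom{\varepsilon}{v}_q=0$ if $v\neq\varepsilon$, and, for all $u,v\in A^*$ and letters $a,b\in A$, $\binom{ua}{vb}_q=q^{|vb|}\binom{u}{vb}_q+\delta_{a,b}\binom{u}{v}_q$, where $\delta_{a,b}$ is the Kronecker delta. *)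

(* Defs.v *)
From HB Require Import structures.
From mathcomp Require Import all_boot all_order all_algebra.

Set Implicit Arguments.
Unset Strict Implicit.
Unset Printing Implicit Defensive.

Import GRing.Theory.
Local Open Scope ring_scope.

(* The defining recursion peels off the last letters of both words, so the
   structural recursion is carried out on the reversed words; [qbinom_rcons]
   below is the recursion as stated on the words themselves. *)
Fixpoint qbinom_rev (A : eqType) (u v : seq A) : {poly nat} :=
  match v with
  | [::] => 1
  | b :: v' =>
    match u with
    | [::] => 0
    | a :: u' =>
      'X^(size v) * qbinom_rev u' v + (a == b)%:R * qbinom_rev u' v'
    end
  end.

Definition qbinom (A : eqType) (u v : seq A) : {poly nat} :=
  qbinom_rev (rev u) (rev v).

Lemma qbinom_nilr (A : eqType) (u : seq A) : qbinom u [::] = 1.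
Proof. by rewrite /qbinom; case: (rev u). Qed.

Lemma qbinom_nill (A : eqType) (v : seq A) : v != [::] -> qbinom [::] v = 0.
Proof. by case/lastP: v => // v b _; rewrite /qbinom rev_rcons. Qed.

Lemma qbinom_rcons (A : eqType) (u v : seq A) (a b : A) :
  qbinom (rcons u a) (rcons v b) =
  'X^(size (rcons v b)) * qbinom u (rcons v b) + (a == b)%:R * qbinom u v.
Proof. by rewrite /qbinom !rev_rcons /= size_rev size_rcons. Qed.

(* Main.v *)
Require Import Defs.
From mathcomp Require Import all_boot all_order all_algebra.
From mathcomp Require Import zify.

Import GRing.Theory.
Local Open Scope ring_scope.

(** In terms of the occurrences of [x] in [u], with letters of [u] indexed from
    the right starting at 0, the [q]-binomial is the sum of
    [q^(sum_j (e_j - (k - j)))] over the occurrences [e_1 > ... > e_k] of [x].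
    In degree [m + 1 - k], every occurrence has [e_1 <= m], with equality only
    for [m, k - 2, ..., 0].  Hence the coefficients of that degree depend only
    on the letters of index below [m], apart from one occurrence that reveals
    the letter of index [m] (or its absence).  The constant coefficients give
    the suffix of length [k], and the other letters, as well as the length of
    [u], follow one at a time from right to left. *)

Lemma qbinom_rev_nilr (A : eqType) (u : seq A) : qbinom_rev u [::] = 1.
Proof. by case: u. Qed.

Lemma coef_qbinom_rev_cons (A : eqType) (a b : A) (u v : seq A) (d : nat) :
  (qbinom_rev (a :: u) (b :: v))`_d =
  (if (d <= size v)%N then 0 else (qbinom_rev u (b :: v))`_(d - (size v).+1))
  + (if a == b then (qbinom_rev u v)`_d else 0).
Proof.
rewrite /= coefD coefXnM ltnS; congr (_ + _).
by case: (a == b); rewrite ?mul1r ?mul0r ?coef0.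
Qed.

(** In degree 0 no letter of [u] can be skipped before [v] is exhausted. *)
Lemma coef0_qbinom_rev (A : eqType) (u v : seq A) :
  (qbinom_rev u v)`_0 = prefix v u.
Proof.
elim: u v => [|a u IH] [|b v]; rewrite ?coef1 ?coef0 //.
by rewrite coef_qbinom_rev_cons leq0n add0r IH /= eq_sym; case: (b == a).
Qed.

Local Arguments qbinom_rev : simpl never.

(** Each skip before [v] is exhausted costs degree at least 1, so an occurrence reaching into [s]
    has degree at least [size t + 1 - size v]. *)
Lemma coef_qbinom_rev_cat (A : eqType) (t s v : seq A) (d : nat) :
  (d + size v <= size t)%N ->
  (qbinom_rev (t ++ s) v)`_d = (qbinom_rev t v)`_d.
Proof.
elim: t v d => [|a t IH] [|b v] d; rewrite ?qbinom_rev_nilr //=; first by lia.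
rewrite -/(cat t s) => le_dv; rewrite !coef_qbinom_rev_cons.
rewrite (IH v); last by lia.
by case: (leqP d (size v)) => // lt_vd; rewrite IH //=; lia.
Qed.

(** This is the first degree that [c] can affect: every skip must cost exactly 1, hence come when
    one letter of [v] is left. *)
Lemma coef_qbinom_rev_cat_cons (A : eqType) (t s v : seq A) (c : A) (d : nat) :
  (0 < size v)%N -> (d + size v = (size t).+1)%N ->
  (qbinom_rev (t ++ c :: s) v)`_d =
  (qbinom_rev t v)`_d + (v == rcons (take (size v).-1 t) c).
Proof.
elim: t v d => [|a t IH] [|b v] d //= _.
  case: v => [|b' v] /= dE; last by lia.
  have -> : d = 0%N by lia.
  rewrite (_ : qbinom_rev [::] [:: b] = 0) // coef0 add0r.
  rewrite coef_qbinom_rev_cons add0r qbinom_rev_nilr coef1 eqseq_cons andbT.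
  by rewrite eq_sym; case: (b == c).
move=> dE; rewrite !coef_qbinom_rev_cons.
case: v dE => [|b' v] dE.
  rewrite !qbinom_rev_nilr /= in dE *.
  case: d dE => [|d] dE /=; first by lia.
  by rewrite IH ?take0; [exact: addrAC | | rewrite /=; lia].
rewrite (IH (b' :: v)) //=; last by move: dE => /=; lia.
have -> : (b :: b' :: v == a :: rcons (take (size v) t) c)
        = (a == b) && (b' :: v == rcons (take (size v) t) c).
  by rewrite eqseq_cons eq_sym.
(* With at least two letters pending, a skip costs at least 2, and the degree left is too low to
   reach [c]. *)
have -> : (if (d <= (size v).+1)%N then 0
           else (qbinom_rev (t ++ c :: s) [:: b, b' & v])`_(d - (size v).+2))
        = (if (d <= (size v).+1)%N then 0
           else (qbinom_rev t [:: b, b' & v])`_(d - (size v).+2)).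
  case: leqP => // lt_vd; apply: coef_qbinom_rev_cat.
  by move: dE lt_vd => /=; lia.
by case: (a == b); rewrite /= ?addr0 ?addrA.
Qed.

Lemma qbinom_rev_cat_inj (A : eqType) (k : nat) (t s s' : seq A) :
  (0 < k)%N -> (k <= (size t).+1)%N ->
  (forall v, size v = k -> qbinom_rev (t ++ s') v = qbinom_rev (t ++ s) v) ->
  s' = s.
Proof.
move=> k_gt0; elim: s t s' => [|c s IH] t s' le_kt eq_s.
  case: s' eq_s => // c' s' eq_s.
  (* The coefficient of [v] in degree [(size t).+1 - k] is one larger when [c'] follows [t] than
     when nothing does. *)
  pose v := rcons (take k.-1 t) c'.
  have sz_v : size v = k by rewrite size_rcons size_takel; lia.
  have := congr1 (fun p : {poly nat} => p`_((size t).+1 - k)) (eq_s v sz_v).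
  by rewrite /= cats0 coef_qbinom_rev_cat_cons sz_v ?eqxx //= /GRing.add /=; lia.
pose v := rcons (take k.-1 t) c.
have sz_v : size v = k by rewrite size_rcons size_takel; lia.
have := congr1 (fun p : {poly nat} => p`_((size t).+1 - k)) (eq_s v sz_v).
rewrite /= (@coef_qbinom_rev_cat_cons _ t s); [|lia|lia].
rewrite sz_v eqxx.
case: s' eq_s => [|c' s'] eq_s.
  by rewrite cats0 /GRing.add /=; lia.
rewrite coef_qbinom_rev_cat_cons; [|lia|lia].
rewrite sz_v eqseq_rcons eqxx /=.
(* If the letters differ, only the side with [c] gains the extra 1. *)
case: eqP => [eq_c _|_]; last by rewrite /GRing.add /=; lia.
rewrite -eq_c in eq_s *; congr (_ :: _).
apply: (IH (rcons t c)) => [|w sz_w]; first by rewrite size_rcons; lia.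
by rewrite !cat_rcons eq_s.
Qed.

Local Close Scope ring_scope.

Theorem corollary4p2 (A : finType) (u : seq A) (k : nat)
  (hk : 1 <= k <= size u) (u' : seq A)
  (h : forall x : k.-tuple A, qbinom u' x = qbinom u x) :
  u' = u.
Proof.
case/andP: hk => k_gt0 le_ku.
have eq_rev v : size v = k -> qbinom_rev (rev u') v = qbinom_rev (rev u) v.
  move=> sz_v; have sz_rv : size (rev v) == k by rewrite size_rev sz_v.
  by have := h (Tuple sz_rv); rewrite /qbinom /= revK.
pose t := take k (rev u).
have sz_t : size t = k by rewrite size_takel ?size_rev.
have : prefix t (rev u').
  (* For [rev u] this constant coefficient is 1. *)
  have := congr1 (fun p : {poly nat} => p`_0)%R (eq_rev t sz_t).
  by rewrite /= !coef0_qbinom_rev prefix_take; case: prefix.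
case/prefixP=> s' u'E; have uE := esym (cat_take_drop k (rev u)).
apply: (can_inj revK); rewrite u'E uE; congr (_ ++ _).
apply: (@qbinom_rev_cat_inj _ k t) => // [|v sz_v]; first by rewrite sz_t.
by rewrite -u'E -uE eq_rev.
Qed.
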